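(* Let $Q=Q^{T}\in\mathbb{R}^{n\times n}$ be a symmetric indefinite matrix and let $\boldsymbol{c}\in\mathbb{R}^{n}$ be a nonzero vector. Suppose $\overline{\boldsymbol{\lambda}}\in\mathcal{S}^{+}$ is a critical point of the Lagrangian dual function $g$ (that is, $\nabla g(\overline{\boldsymbol{\lambda}})=0$), and let $\overline{\boldsymbol{x}}=Q^{-1}(\overline{\boldsymbol{\lambda}})\,\boldsymbol{c}$. Then $g(\overline{\boldsymbol{\lambda}})=L(\overline{\boldsymbol{x}},\overline{\boldsymbol{\lambda}})=f(\overline{\boldsymbol{x}})$, and there is no duality gap between the primal and dual problems, that is, $\min_{\boldsymbol{x}\in\{-1,1\}^{n}}f(\boldsymbol{x})=\max_{\boldsymbol{\lambda}\in\mathcal{S}^{+}}g(\boldsymbol{\lambda})$.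
   Context: The primal problem is the boolean quadratic programming (BQP) problem $\min\{f(\boldsymbol{x})\mid\boldsymbol{x}\in\{-1,1\}^{n}\}$ with $f(\boldsymbol{x})=\frac{1}{2}\boldsymbol{x}^{T}Q\boldsymbol{x}-\boldsymbol{c}^{T}\boldsymbol{x}$ for $\boldsymbol{x}\in\mathbb{R}^n$. For $\boldsymbol{\lambda}=(\lambda_1,\dots,\lambda_n)^T\in\mathbb{R}^n$, let $Q(\boldsymbol{\lambda})=Q+\operatorname{diag}(\boldsymbol{\lambda})$, where $\operatorname{diag}(\boldsymbol{\lambda})$ is the diagonal matrix with diagonal entries $\lambda_1,\dots,\lambda_n$, and write $Q^{-1}(\boldsymbol{\lambda})$ for the inverse of the matrix $Q(\boldsymbol{\lambda})$. Let $\boldsymbol{e}\in\mathbb{R}^n$ be the vector with all entries equal to one. The Lagrangian $L:\mathbb{R}^n\times\mathbb{R}^n\to\mathbb{R}$ is $L(\boldsymbol{x},\boldsymbol{\lambda})=\frac{1}{2}\boldsymbol{x}^{T}Q\boldsymbol{x}-\boldsymbol{c}^{T}\boldsymbol{x}+\sum_{i=1}^{n}\frac{1}{2}\lambda_i(x_i^{2}-1)=\frac{1}{2}\boldsymbol{x}^{T}Q(\boldsymbol{\lambda})\boldsymbol{x}-\boldsymbol{c}^{T}\boldsymbol{x}-\frac{1}{2}\boldsymbol{\lambda}^{T}\boldsymbol{e}$. The dual feasible space is $\mathcal{S}^{+}=\{\boldsymbol{\lambda}\in\mathbb{R}^{n}\mid Q(\boldsymbol{\lambda})\succ 0\}$,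 where $\succ 0$ means positive definite. The Lagrangian dual function $g:\mathcal{S}^{+}\to\mathbb{R}$ is $g(\boldsymbol{\lambda})=-\frac{1}{2}\boldsymbol{c}^{T}Q^{-1}(\boldsymbol{\lambda})\boldsymbol{c}-\frac{1}{2}\boldsymbol{\lambda}^{T}\boldsymbol{e}$, and the Lagrangian dual problem is $\max_{\boldsymbol{\lambda}\in\mathcal{S}^{+}}g(\boldsymbol{\lambda})$. *)

(* Defs.v *)
From HB Require Import structures.
From mathcomp Require Import all_boot all_order all_algebra.
From mathcomp Require Import all_classical all_reals all_analysis.

Set Implicit Arguments.
Unset Strict Implicit.
Unset Printing Implicit Defensive.

Import Order.TTheory GRing.Theory Num.Theory.
Import numFieldNormedType.Exports.

Local Open Scope classical_set_scope.
Local Open Scope ring_scope.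

Definition qform (R : realType) (n : nat) (A : 'M[R]_n) (x : 'cV[R]_n) : R :=
  (x^T *m A *m x) 0 0.

Definition dotv (R : realType) (n : nat) (u v : 'cV[R]_n) : R :=
  (u^T *m v) 0 0.

Definition posdef (R : realType) (n : nat) (A : 'M[R]_n) : Prop :=
  forall x : 'cV[R]_n, x != 0 -> 0 < qform A x.

Definition indefinite (R : realType) (n : nat) (A : 'M[R]_n) : Prop :=
  (exists x : 'cV[R]_n, 0 < qform A x) /\
  (exists y : 'cV[R]_n, qform A y < 0).

(* A partial derivative that does not exist has an unspecified value in ['D]. *)
Definition gradient (R : realType) (n : nat) (h : 'cV[R]_n -> R)
    (x : 'cV[R]_n) : 'cV[R]_n :=
  \col_(i < n) 'D_(delta_mx i 0) h x.

Definition is_minimum (R : realType) (T : Type) (h : T -> R) (A : set T)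
    (m : R) : Prop :=
  (h @` A) m /\ lbound (h @` A) m.

Definition is_maximum (R : realType) (T : Type) (h : T -> R) (A : set T)
    (m : R) : Prop :=
  (h @` A) m /\ ubound (h @` A) m.

Definition sign_cube (R : realType) (n : nat) : set 'cV[R]_n :=
  [set x | forall i : 'I_n, x i 0 = -1 \/ x i 0 = 1].

Definition bqp (R : realType) (n : nat) (Q : 'M[R]_n) (c : 'cV[R]_n)
    (x : 'cV[R]_n) : R :=
  2^-1 * qform Q x - dotv c x.

Definition Qlam (R : realType) (n : nat) (Q : 'M[R]_n)
    (lam : 'cV[R]_n) : 'M[R]_n :=
  Q + diag_mx lam^T.

Definition lagrangian (R : realType) (n : nat) (Q : 'M[R]_n) (c : 'cV[R]_n)
    (x lam : 'cV[R]_n) : R :=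
  2^-1 * qform Q x - dotv c x
  + \sum_(i < n) 2^-1 * lam i 0 * (x i 0 ^+ 2 - 1).

Definition dual_feasible (R : realType) (n : nat) (Q : 'M[R]_n) :
    set 'cV[R]_n :=
  [set lam | posdef (Qlam Q lam)].

(* Total on R^n, but [invmx] is the inverse only where [Qlam Q lam] is
   invertible, so the values are meaningful on the open set
   [dual_feasible Q]; there the function is smooth and its [gradient] is the
   true one. *)
Definition dual_fun (R : realType) (n : nat) (Q : 'M[R]_n) (c : 'cV[R]_n)
    (lam : 'cV[R]_n) : R :=
  - (2^-1 * qform (invmx (Qlam Q lam)) c) - 2^-1 * dotv lam (const_mx 1).

(* Main.v *)
(** Sherman-Morrison turns the difference quotients of the dual function into
    explicit rational functions, which shows that its [i]-th partial derivative
    is [(x_i ^ 2 - 1) / 2]; hence a critical point yields [x] in the sign cube.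
    Completing the square gives
    [L(z, mu) - g(mu) = (z - y)^T Q(mu) (z - y) / 2] with [y = Q(mu)^-1 c]: this
    vanishes at [z = x], [mu = lam], and is nonnegative on [S+], i.e. weak duality
    since [L = f] on the sign cube. *)
Require Import Defs.
From mathcomp Require Import all_boot all_order all_algebra.
From mathcomp Require Import all_classical all_reals all_analysis.
From mathcomp Require Import ring.

Set Implicit Arguments.
Unset Strict Implicit.
Unset Printing Implicit Defensive.

Import Order.TTheory GRing.Theory Num.Theory.
Import numFieldNormedType.Exports.

Local Open Scope classical_set_scope.
Local Open Scope ring_scope.

(** A singular matrix kills some nonzero row vector, and the quadratic form vanishes at its
    transpose. *)
Lemma posdef_unitmx (R : realType) (n : nat) (A : 'M[R]_n) :
  posdef A -> A \in unitmx.
Proof.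
move=> posA; rewrite unitmxE unitfE; apply/negP => /det0P[v v0 vA].
have vT0 : v^T != 0 by rewrite trmx_eq0.
by have := posA _ vT0; rewrite /qform trmxK vA mul0mx mxE ltxx.
Qed.

Lemma trmx_Qlam (R : realType) (n : nat) (Q : 'M[R]_n) (lam : 'cV[R]_n) :
  Q^T = Q -> (Qlam Q lam)^T = Qlam Q lam.
Proof. by move=> symQ; rewrite /Qlam linearD /= symQ tr_diag_mx. Qed.

(** A step along one coordinate is a rank-one update, the shape that [sherman_morrison] inverts. The
    summand order on the left is that of the difference quotient in ['D]. *)
Lemma Qlam_delta (R : realType) (n : nat) (Q : 'M[R]_n) (lam : 'cV[R]_n)
    (h : R) (i : 'I_n) :
  Qlam Q (h *: delta_mx i 0 + lam) =
  Qlam Q lam + h *: (delta_mx i 0 *m (delta_mx i 0 : 'cV[R]_n)^T).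
Proof.
rewrite /Qlam -addrA; congr (_ + _); rewrite trmx_delta mul_delta_mx.
apply/matrixP => j k; rewrite !mxE.
case: (eqVneq j k) => [->|njk]; first by rewrite eqxx andbT addrC andbb mulr1n.
rewrite !mulr0n add0r; case: eqP => [ji|]; last by rewrite mulr0.
by case: eqP => [ki|]; [rewrite ji ki eqxx in njk|rewrite mulr0].
Qed.

Lemma qform_diag (R : realType) (n : nat) (lam z : 'cV[R]_n) :
  qform (diag_mx lam^T) z = \sum_(i < n) lam i 0 * z i 0 ^+ 2.
Proof.
rewrite /qform mul_mx_diag mxE; apply: eq_bigr => i _.
by rewrite !mxE mulrAC mulrC expr2.
Qed.

Lemma dotv1 (R : realType) (n : nat) (lam : 'cV[R]_n) :
  dotv lam (const_mx 1) = \sum_(i < n) lam i 0.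
Proof. by rewrite /dotv mxE; apply: eq_bigr => i _; rewrite !mxE mulr1. Qed.

Lemma lagrangianE (R : realType) (n : nat) (Q : 'M[R]_n) (c z lam : 'cV[R]_n) :
  lagrangian Q c z lam =
  2^-1 * qform (Qlam Q lam) z - dotv c z - 2^-1 * dotv lam (const_mx 1).
Proof.
rewrite /lagrangian.
have -> : qform (Qlam Q lam) z = qform Q z + qform (diag_mx lam^T) z.
  by rewrite /qform /Qlam mulmxDr mulmxDl mxE.
under eq_bigr do rewrite mulrBr mulr1 -!mulrA.
by rewrite sumrB -!mulr_sumr qform_diag dotv1; ring.
Qed.

Lemma lagrangian_sign_cube (R : realType) (n : nat) (Q : 'M[R]_n)
    (c z lam : 'cV[R]_n) :
  sign_cube z -> lagrangian Q c z lam = bqp Q c z.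
Proof.
move=> zS; rewrite /lagrangian big1 ?addr0// => i _.
by case: (zS i) => ->; rewrite ?sqrrN expr1n subrr mulr0.
Qed.

(** The cross term is kept as [A *m v] so that it collapses to [c] when [v] is [invmx A *m c]. *)
Lemma qformB (R : realType) (n : nat) (A : 'M[R]_n) (u v : 'cV[R]_n) :
  A^T = A -> qform A (u - v) = qform A u - 2 * dotv (A *m v) u + qform A v.
Proof.
move=> symA; rewrite /qform /dotv trmx_mul symA.
(* The two cross terms agree because a 1 by 1 matrix equals its transpose and [A] is symmetric. *)
have uv : (u^T *m A *m v) 0 0 = (v^T *m A *m u) 0 0.
  transitivity ((u^T *m A *m v)^T 0 0); first by rewrite [RHS]mxE.
  by rewrite !trmx_mul trmxK symA mulmxA.
rewrite [(u - v)^T]linearB /= mulmxBl mulmxBl !mulmxBr.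
have E (a b c d : 'M[R]_1) :
  (a - b - (c - d)) 0 0 = a 0 0 - b 0 0 - (c 0 0 - d 0 0) by rewrite !mxE.
by rewrite E uv; ring.
Qed.

Lemma lagrangian_sub_dual (R : realType) (n : nat) (Q : 'M[R]_n)
    (c z lam : 'cV[R]_n) :
  Q^T = Q -> Qlam Q lam \in unitmx ->
  lagrangian Q c z lam - dual_fun Q c lam =
  2^-1 * qform (Qlam Q lam) (z - invmx (Qlam Q lam) *m c).
Proof.
move=> symQ unitA; have symA := trmx_Qlam lam symQ.
rewrite lagrangianE /dual_fun (qformB _ _ symA) mulKVmx//.
have -> : qform (Qlam Q lam) (invmx (Qlam Q lam) *m c) =
          qform (invmx (Qlam Q lam)) c.
  by rewrite /qform trmx_mul trmx_inv symA mulmxKV// mulmxA.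
by field.
Qed.

Lemma dual_fun_le_lagrangian (R : realType) (n : nat) (Q : 'M[R]_n)
    (c z lam : 'cV[R]_n) :
  Q^T = Q -> dual_feasible Q lam -> dual_fun Q c lam <= lagrangian Q c z lam.
Proof.
move=> symQ posA; rewrite -subr_ge0 lagrangian_sub_dual//; last first.
  exact: posdef_unitmx.
rewrite mulr_ge0 ?invr_ge0//.
(* [posdef] speaks of nonzero vectors only, so the zero vector is treated apart. *)
have [->|y0] := eqVneq (z - invmx (Qlam Q lam) *m c) 0; last exact/ltW/posA.
by rewrite /qform mulmx0 mxE.
Qed.

(** The right-hand side is checked to be a right inverse; for square matrices this yields both
    invertibility and the inverse. *)
Lemma sherman_morrison (R : realType) (n : nat) (A : 'M[R]_n) (u v : 'cV[R]_n)
    (h : R) :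
  A \in unitmx -> 1 + h * (v^T *m invmx A *m u) 0 0 != 0 ->
  invmx (A + h *: (u *m v^T)) =
  invmx A - (h / (1 + h * (v^T *m invmx A *m u) 0 0)) *:
            (invmx A *m u *m (v^T *m invmx A)).
Proof.
set a := (_ *m _ *m _) 0 0 => unitA a0; set B := RHS.
suff AB1 : (A + h *: (u *m v^T)) *m B = 1%:M.
  by rewrite -[LHS]mulmx1 -AB1 mulKmx//; case: (mulmx1_unit AB1).
(* The inner factor [v^T *m invmx A *m u] is the scalar [a] and can be pulled out. *)
have E : (u *m v^T) *m (invmx A *m u *m (v^T *m invmx A)) =
    a *: (u *m (v^T *m invmx A)).
  have -> : (u *m v^T) *m (invmx A *m u *m (v^T *m invmx A)) =
      u *m (v^T *m invmx A *m u) *m (v^T *m invmx A) by rewrite !mulmxA.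
  rewrite [v^T *m _ *m u]mx11_scalar -/a mul_mx_scalar.
  by rewrite -scalemxAl.
rewrite /B mulmxDl !mulmxBr mulmxV// -!scalemxAr -!scalemxAl E.
rewrite -[invmx A *m u *m _]mulmxA mulKVmx// -[u *m v^T *m _]mulmxA.
set W := u *m _; rewrite !scalerA -addrA -[RHS]addr0; congr (_ + _).
(* With [k = h / (1 + h * a)], the coefficient of [W] is [h - k * (1 + h * a) = 0]. *)
by rewrite -scaleNr -scalerBl -scalerDl (_ : _ + _ = 0) ?scale0r//; field.
Qed.

Lemma derive_dual_fun (R : realType) (n : nat) (Q : 'M[R]_n)
    (c lam : 'cV[R]_n) (i : 'I_n) :
  Q^T = Q -> Qlam Q lam \in unitmx ->
  'D_(delta_mx i 0) (dual_fun Q c) lam =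
  2^-1 * (((invmx (Qlam Q lam) *m c) i 0) ^+ 2 - 1).
Proof.
move=> symQ unitA; set e : 'cV[R]_n := delta_mx i 0.
set x := invmx _ *m c; set b := (e^T *m invmx (Qlam Q lam) *m e) 0 0.
have cvg_den : 1 + h * b @[h --> (0 : R)^'] --> (1 : R).
  apply: cvg_within_filter.
  have := cvgD (cvg_cst (1 : R)) (cvgM (@cvg_id _ (nbhs (0 : R))) (cvg_cst b)).
  by rewrite mul0r addr0; apply.
(* The function of [h] on the left is the closed form of the difference quotient for small nonzero
   [h]. *)
have cvg_quot : 2^-1 * (x i 0 ^+ 2 * (1 + h * b)^-1 - 1) @[h --> (0 : R)^'] -->
    2^-1 * (x i 0 ^+ 2 - 1).
  apply: cvgM; first exact: cvg_cst.
  apply: cvgB; last exact: cvg_cst.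
  have := cvgM (cvg_cst (x i 0 ^+ 2)) (cvgV (oner_neq0 R) cvg_den).
  by rewrite invr1 mulr1; apply.
apply: cvg_lim => //; apply: cvg_trans cvg_quot.
apply: near_eq_cvg; near=> h.
have h0 : h != 0 by near: h; exact: nbhs_dnbhs_neq.
(* The denominator tends to 1, so the side condition of [sherman_morrison] holds near 0. *)
have hb0 : 1 + h * b != 0.
  by near: h; exact: (cvgr_neq0 _ cvg_den (oner_neq0 R)).
have dotv_delta : dotv (h *: e + lam) (const_mx 1) =
    h + dotv lam (const_mx 1).
  rewrite !dotv1; under eq_bigr do rewrite mxE.
  rewrite big_split /= (bigD1 i)//= big1 => [|j /negPf ji]; rewrite !mxE.
    by rewrite !eqxx mulr1 addr0.
  by rewrite ji mulr0.
have qform_delta : qform (invmx (Qlam Q (h *: e + lam))) c =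
    qform (invmx (Qlam Q lam)) c - h / (1 + h * b) * x i 0 ^+ 2.
  rewrite Qlam_delta sherman_morrison// -/e -/b /qform mulmxBr mulmxBl.
  (* Both outer factors of the rank-one correction reduce to the entry [x i 0], the second by
     symmetry of [Qlam Q lam]; hence the square. *)
  have ex : e^T *m invmx (Qlam Q lam) *m c = (x i 0)%:M.
    rewrite -mulmxA -/x [LHS]mx11_scalar /e trmx_delta -rowE mxE//.
  have xe : c^T *m (invmx (Qlam Q lam) *m e) = (x i 0)%:M.
    rewrite -[RHS]tr_scalar_mx -ex !trmx_mul trmxK trmx_inv trmx_Qlam//.
  rewrite -scalemxAr -scalemxAl mulmxA xe -[_%:M *m _ *m c]mulmxA ex -scalar_mxM.
  by rewrite !mxE eqxx mulr1n expr2.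
rewrite /= /dual_fun qform_delta dotv_delta /GRing.scale /=.
by field; rewrite hb0 h0.
Unshelve. all: by end_near.
Qed.

Theorem mainTheorem2 (R : realType) (n : nat) (Q : 'M[R]_n) (c : 'cV[R]_n)
    (Q_sym : Q^T = Q) (Q_indef : indefinite Q) (c_neq0 : c != 0)
    (lam : 'cV[R]_n) (lam_feasible : dual_feasible Q lam)
    (lam_critical : gradient (dual_fun Q c) lam = 0)
    (x : 'cV[R]_n) (x_def : x = invmx (Qlam Q lam) *m c) :
  [/\ dual_fun Q c lam = lagrangian Q c x lam,
      lagrangian Q c x lam = bqp Q c x &
      exists v : R, is_minimum (bqp Q c) (@sign_cube R n) v /\
                    is_maximum (dual_fun Q c) (dual_feasible Q) v].
Proof.
have unitA := posdef_unitmx lam_feasible.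
have xS : sign_cube x.
  move=> i; have /matrixP/(_ i 0) := lam_critical.
  rewrite !mxE derive_dual_fun// -x_def => /eqP.
  rewrite mulf_eq0 invr_eq0 pnatr_eq0 /= subr_eq0 sqrf_eq1.
  by case/orP => /eqP; [right|left].
have gL : dual_fun Q c lam = lagrangian Q c x lam.
  apply/eqP; rewrite eq_sym -subr_eq0 lagrangian_sub_dual// -x_def subrr.
  by rewrite /qform mulmx0 mxE mulr0.
have Lf := lagrangian_sign_cube Q c lam xS.
split=> //; exists (bqp Q c x); split; split.
- by exists x.
(* With [lam] fixed and [z] varying: f(x) = g(lam) <= L(z, lam) = f(z). *)
- move=> _ [z zS <-]; rewrite -Lf -gL -(lagrangian_sign_cube Q c lam zS).
  exact: dual_fun_le_lagrangian.
- by exists lam => //; rewrite gL.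
(* With [x] fixed and [mu] varying: g(mu) <= L(x, mu) = f(x). *)
- move=> _ [mu mu_feasible <-]; rewrite -(lagrangian_sign_cube Q c mu xS).
  exact: dual_fun_le_lagrangian.
Qed.
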